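(* (a) Every proper alternating odd bicycle is not adaptably $2$-colorable. (b) Every improper alternating bicycle is adaptably $2$-colorable.
   Context: Graphs are finite and simple; $c:E\to\{red,blue\}$ is a (not necessarily proper) edge coloring. A vertex coloring $\sigma:V\to\{red,blue\}$ is adapted to $c$ if for every edge $uv$ either $\sigma(u)\neq c(uv)$ or $\sigma(v)\ne c(uv)$; $(G,c)$ is adaptably $2$-colorable if some vertex coloring is adapted to $c$. A bicycle is a graph composed of a path $P=v_1v_2\cdots v_s$ (distinct vertices) along with two further edges $v_1v_i$ and $v_jv_s$ for some $i,j\in\{1,\dots,s\}$. It is proper if $i\le j$ and improper if $i>j$. It is odd if the cycles $C_1=v_1v_2\cdots v_iv_1$ and $C_2=v_jv_{j+1}\cdots v_sv_j$ are both of odd length. A path $v_1v_2\cdots v_l$ is alternating (under $c$) if $c(v_{t-1}v_t)\ne c(v_tv_{t+1})$ for all $2\le t\le l-1$. A bicycle with edge coloring $c$ is alternating if it can be decomposed into an alternating path $P=v_1v_2\cdots v_s$ and two edges $v_1v_i$ and $v_sv_j$ with $c(v_1v_i)\neq c(v_1v_2)$ and $c(v_sv_j)\neq c(v_{s-1}v_s)$; ''proper'', ''improper'' and ''odd'' are understood with respect to this decomposition. *)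

(* Defs.v *)
From mathcomp Require Import all_boot.

Set Implicit Arguments.
Unset Strict Implicit.
Unset Printing Implicit Defensive.

Variant color := Red | Blue.

(* A finite simple graph is a symmetric irreflexive [e : rel V]; its edges are
   the unordered pairs [set x; y] with [e x y].  An edge colouring is a function
   on sets of vertices, of which only the values at edges are ever used. *)
Section Coloring.
Variables (V : finType) (e : rel V) (c : {set V} -> color).

Definition adapted (sigma : V -> color) : Prop :=
  forall u v, e u v -> sigma u <> c [set u; v] \/ sigma v <> c [set u; v].

Definition adaptably_2_colorable : Prop := exists sigma, adapted sigma.

End Coloring.

(* A vertex sequence v_1 ... v_s is given by [v : nat -> V], of which only the
   values at the indices 1, ..., s are used. *)
Section Bicycle.
Variables (V : finType) (e : rel V) (c : {set V} -> color).
Variables (s : nat) (v : nat -> V) (i j : nat).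

Definition path_vertices : seq V := [seq v t | t <- index_iota 1 s.+1].

Definition path_edges : seq {set V} :=
  [seq [set v t; v t.+1] | t <- index_iota 1 s].

Definition bicycle_edges : seq {set V} :=
  [:: [set v 1; v i], [set v j; v s] & path_edges].

(* Uniqueness of [bicycle_edges] says that v_1 v_i and v_j v_s are two different
   edges, neither of which lies on the path.  The degenerate values i = 1 and
   j = s would make v_1 v_i or v_j v_s a loop, so they are ruled out as soon as
   [e] is irreflexive. *)
Definition bicycle_decomposition : Prop :=
  [/\ uniq path_vertices,
      forall x, x \in path_vertices,
      (1 <= i <= s) && (1 <= j <= s),
      uniq bicycle_edges &
      forall x y, e x y = ([set x; y] \in bicycle_edges)].

Definition alternating_path : Prop :=
  forall t, 2 <= t <= s.-1 -> c [set v t.-1; v t] <> c [set v t; v t.+1].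

Definition alternating_decomposition : Prop :=
  [/\ bicycle_decomposition,
      alternating_path,
      c [set v 1; v i] <> c [set v 1; v 2] &
      c [set v s; v j] <> c [set v s.-1; v s]].

Definition proper : bool := i <= j.
Definition improper : bool := j < i.

(* The cycles C_1 = v_1 ... v_i v_1 and C_2 = v_j ... v_s v_j, by their vertices
   without repetition of the starting point, so that [size] is the length. *)
Definition cycle1 : seq V := [seq v t | t <- index_iota 1 i.+1].
Definition cycle2 : seq V := [seq v t | t <- index_iota j s.+1].

Definition odd_cycles : bool := odd (size cycle1) && odd (size cycle2).

End Bicycle.

Definition proper_alternating_odd_bicycle
    (V : finType) (e : rel V) (c : {set V} -> color) : Prop :=
  exists (s : nat) (v : nat -> V) (i j : nat),
    [/\ alternating_decomposition e c s v i j, proper i j & odd_cycles s v i j].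

Definition improper_alternating_bicycle
    (V : finType) (e : rel V) (c : {set V} -> color) : Prop :=
  exists (s : nat) (v : nat -> V) (i j : nat),
    alternating_decomposition e c s v i j /\ improper i j.

(* Main.v *)
Require Import Defs.
From mathcomp Require Import all_boot.
From mathcomp Require Import zify.

Set Implicit Arguments.
Unset Strict Implicit.
Unset Printing Implicit Defensive.

(** Write C_0 for the colour of v_1 v_i, C_t for the colour of v_t v_(t+1) and
    C_s for the colour of v_j v_s; in an alternating bicycle C_0, ..., C_s
    alternate.  If an adapted colouring gives v_m the colour C_m, then it gives
    v_t the colour C_t for all t >= m.  For (a), the cycle C_1 being odd, the
    edge v_1 v_i forces this for m = 1 or m = i, so v_j and v_s get the colours
    C_j and C_s, which agree because C_2 is odd: v_j v_s is violated.
    For (b), colour v_t by C_(t-1) for t <= k and by C_t for t > k: this respects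
    every edge of the path, and one of k = 0, k = s, k = j respects
    the other two edges. *)

Lemma color_eq_dec (x y : color) : {x = y} + {x <> y}.
Proof. by decide equality. Qed.

Lemma color_neq2 (x y z : color) : x <> z -> y <> z -> x = y.
Proof. by case: x; case: y; case: z. Qed.

Definition alternating_upto (s : nat) (C : nat -> color) : Prop :=
  forall t, t < s -> C t <> C t.+1.

(** Adaptedness read on indices: [tau t] is the colour of v_t, and the last two clauses are the
    edges v_1 v_i and v_j v_s. *)
Definition adapted_indices (s i j : nat) (C tau : nat -> color) : Prop :=
  [/\ forall t, 1 <= t < s -> tau t <> C t \/ tau t.+1 <> C t,
      tau 1 <> C 0 \/ tau i <> C 0 &
      tau j <> C s \/ tau s <> C s].

Lemma alternating_parity (s : nat) (C : nat -> color) (t : nat) :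
  alternating_upto s C -> t <= s -> C t = if odd t then C 1 else C 0.
Proof.
move=> altC; elim: t => [//|t IHt] lt_ts.
have C01 : C 0 <> C 1 by apply: altC; lia.
have := altC t lt_ts; rewrite IHt ?(ltnW lt_ts) //=.
by case: (odd t) => /= neqC; apply: color_neq2 (nesym neqC) _ => // /esym.
Qed.

(** If [tau t = C t], the edge v_t v_(t+1) forces [tau t.+1 <> C t]; also [C t.+1 <> C t], and there
    are only two colours. *)
Lemma adapted_propagation (s i j : nat) (C tau : nat -> color) (m t : nat) :
  alternating_upto s C -> adapted_indices s i j C tau ->
  1 <= m -> tau m = C m -> m <= t <= s -> tau t = C t.
Proof.
move=> altC [adP _ _] m_gt0 tau_m; elim: t => [|t IHt] /andP[le_mt le_ts].
  by case: m m_gt0 le_mt {tau_m}.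
case: (eqVneq m t.+1) => [<- //|neq_mt].
have tau_t : tau t = C t by apply: IHt; lia.
have [//|neq_tau] : tau t <> C t \/ tau t.+1 <> C t by apply: adP; lia.
exact: color_neq2 neq_tau (nesym (altC t le_ts)).
Qed.

Lemma proper_odd_not_adapted (s i j : nat) (C tau : nat -> color) :
  alternating_upto s C -> 1 <= i <= j -> j <= s -> odd i -> ~~ odd (s - j) ->
  ~ adapted_indices s i j C tau.
Proof.
move=> altC /andP[i_gt0 le_ij] le_js odd_i even_sj adC.
have C01 : C 1 <> C 0 by apply/nesym/altC; lia.
(* As [i] is odd, [C i = C 1] is the colour other than [C 0]; the choice [m = i] is allowed because
   [i <= j]. *)
have [m [m_gt0 le_mj tau_m]] : exists m, [/\ 1 <= m, m <= j & tau m = C m].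
  case: (adC) => _ [neq0|neq0] _; [exists 1 | exists i]; split; try lia.
  - exact: color_neq2 neq0 C01.
  - rewrite (alternating_parity altC) ?odd_i; last lia.
    exact: color_neq2 neq0 C01.
have tau_ge t : m <= t <= s -> tau t = C t.
  exact: adapted_propagation altC adC m_gt0 tau_m.
have Cjs : C j = C s.
  rewrite (alternating_parity (t := j) altC) // (alternating_parity (t := s) altC) //.
  by move: even_sj; rewrite oddB //; case: (odd s); case: (odd j).
by case: adC => _ _ []; apply; rewrite tau_ge ?Cjs //; lia.
Qed.

Lemma improper_adapted (s i j : nat) (C : nat -> color) :
  alternating_upto s C -> 1 <= j < i -> i <= s ->
  exists tau, adapted_indices s i j C tau.
Proof.
move=> altC /andP[j_gt0 lt_ji] le_is.
have altC' t : 1 <= t <= s -> C t.-1 <> C t.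
  by case: t => // t lt_ts; apply: altC; lia.
pose tau k t := if t <= k then C t.-1 else C t.
have path_ok k t : 1 <= t < s -> tau k t <> C t \/ tau k t.+1 <> C t.
  move=> /andP[t_gt0 lt_ts]; rewrite /tau; case: (leqP t k) => [_|lt_kt].
    by left; apply: altC'; lia.
  by right; rewrite leqNgt ltnS (ltnW lt_kt) /=; apply/nesym/altC.
(* With k = 0, v_1 gets [C 1 <> C 0] and v_j gets [C j], which works unless [C j = C s]. *)
case: (color_eq_dec (C j) (C s)) => [eq_js|neq_js]; last first.
  exists (tau 0); split; [exact: path_ok | left | left].
  - by apply/nesym/altC; lia.
  - by rewrite /tau leqNgt j_gt0.
(* With k = s, v_s gets [C s.-1 <> C s] and v_i gets [C i.-1], which works unless [C i.-1 = C 0]. *)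
case: (color_eq_dec (C i.-1) (C 0)) => [eq_i0|neq_i0]; last first.
  exists (tau s); split; [exact: path_ok | right | right].
  - by rewrite /tau le_is.
  - by rewrite /tau leqnn; apply: altC'; lia.
(* Both equalities hold now. As [j < i], v_i gets [C i <> C i.-1 = C 0], while v_j gets
   [C j.-1 <> C j = C s]. *)
exists (tau j); split; [exact: path_ok | right | left].
- by rewrite /tau leqNgt lt_ji /= -eq_i0; apply/nesym/altC'; lia.
- by rewrite /tau leqnn -eq_js; apply: altC'; lia.
Qed.

Section BicycleColoring.
Variables (V : finType) (e : rel V) (c : {set V} -> color).
Variables (s : nat) (v : nat -> V) (i j : nat).

Definition bicycle_color (t : nat) : color :=
  if t == 0 then c [set v 1; v i]
  else if t == s then c [set v s; v j] else c [set v t; v t.+1].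

(** For [s = 1] both extra edges would be [[set v 1; v 1]], against the uniqueness of the edge
    list. *)
Lemma bicycle_length_gt1 : bicycle_decomposition e s v i j -> 1 < s.
Proof.
move=> [_ _ ij_bounds uniqE _]; rewrite ltnNge; apply/negP => le_s1.
have [s1 i1 j1] : [/\ s = 1, i = 1 & j = 1] by split; lia.
by move: uniqE; rewrite s1 i1 j1 /bicycle_edges /= inE eqxx.
Qed.

Lemma alternating_bicycle_color :
  alternating_decomposition e c s v i j -> alternating_upto s bicycle_color.
Proof.
move=> [dec altP alt1 alts] t lt_ts.
have s_gt1 := bicycle_length_gt1 dec; rewrite /bicycle_color.
case: (posnP t) => [->|t_gt0].
  by rewrite /= ifF //; apply/negbTE; lia.
rewrite /= (negbTE (_ : t != s)) ?neq_ltn ?lt_ts //.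
case: eqP => [eq_ts|neq_ts].
  by move: alts; rewrite -eq_ts; exact: nesym.
(* [altP] is indexed by the vertex shared by the two edges, here [v t.+1]. *)
by apply: (altP t.+1); lia.
Qed.

Lemma mem_path_edges (E : {set V}) :
  reflect (exists2 t, 1 <= t < s & E = [set v t; v t.+1]) (E \in path_edges s v).
Proof.
apply: (iffP mapP) => -[t]; first by rewrite mem_index_iota; exists t.
by exists t; rewrite ?mem_index_iota.
Qed.

Lemma adapted_bicycle (sigma : V -> color) :
  bicycle_decomposition e s v i j ->
  adapted e c sigma <-> adapted_indices s i j bicycle_color (sigma \o v).
Proof.
move=> dec; have s_gt1 := bicycle_length_gt1 dec; have [_ _ _ _ edgeE] := dec.
have C0 : bicycle_color 0 = c [set v 1; v i] by [].
have Cs : bicycle_color s = c [set v j; v s].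
  by rewrite /bicycle_color eqxx ifF 1?setUC //; apply/negbTE; lia.
have Ct t : 1 <= t < s -> bicycle_color t = c [set v t; v t.+1].
  by move=> lt_t; rewrite /bicycle_color !ifF //; apply/negbTE; lia.
split=> [ad|[adP ad1 ads] x y].
  split=> [t lt_t| |]; [rewrite Ct //= | rewrite C0 /= | rewrite Cs /=];
    apply: ad; rewrite edgeE !inE.
  - by apply/orP; right; apply/orP; right; apply/mem_path_edges; exists t.
  - by rewrite eqxx.
  - by rewrite eqxx orbT.
(* Equal unordered pairs may list their ends in either order; whichever of [a], [b] avoids the
   colour is [x] or [y]. *)
have endpoints a b : sigma a <> c [set a; b] \/ sigma b <> c [set a; b] ->
    [set x; y] = [set a; b] ->
    sigma x <> c [set x; y] \/ sigma y <> c [set x; y].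
  move=> ad_ab eqE; rewrite eqE.
  have: a \in [set x; y] by rewrite eqE set21.
  have: b \in [set x; y] by rewrite eqE set22.
  by case: ad_ab; rewrite !inE => ad_w /orP[]/eqP eb /orP[]/eqP ea;
    move: ad_w; rewrite ?{1}eb ?{1}ea; auto.
rewrite edgeE !inE; case/or3P => [/eqP|/eqP|/mem_path_edges[t lt_t]];
  apply: endpoints; first by rewrite -C0.
- by rewrite -Cs.
- by rewrite -Ct //; exact: adP.
Qed.

Lemma color_of_indices (tau : nat -> color) :
  uniq (path_vertices s v) ->
  exists sigma, forall t, 1 <= t <= s -> sigma (v t) = tau t.
Proof.
(* [index] counts from 0 and the path from 1, hence the successor. *)
move=> uniqP; exists (fun x => tau (index x (path_vertices s v)).+1) => t lt_t.
have -> : v t = nth (v 1) (path_vertices s v) t.-1.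
  rewrite (nth_map 0) ?size_iota; last lia.
  by rewrite nth_iota; [congr v|]; lia.
rewrite index_uniq ?size_map ?size_iota //; last lia.
by congr tau; lia.
Qed.

End BicycleColoring.

Lemma adapted_indices_ext (s i j : nat) (C tau tau' : nat -> color) :
  1 <= i <= s -> 1 <= j <= s ->
  (forall t, 1 <= t <= s -> tau t = tau' t) ->
  adapted_indices s i j C tau' -> adapted_indices s i j C tau.
Proof.
move=> i_bd j_bd eq_tau [adP ad1 ads].
split=> [t lt_t| |]; rewrite !eq_tau //; try lia; exact: adP.
Qed.

Theorem lemma2p1 :
  (forall (V : finType) (e : rel V) (c : {set V} -> color),
     symmetric e -> irreflexive e ->
     proper_alternating_odd_bicycle e c -> ~ adaptably_2_colorable e c) /\
  (forall (V : finType) (e : rel V) (c : {set V} -> color),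
     symmetric e -> irreflexive e ->
     improper_alternating_bicycle e c -> adaptably_2_colorable e c).
Proof.
split=> V e c _ _ [s [v [i [j]]]].
  move=> [altD le_ij /andP[]]; rewrite /Defs.proper in le_ij.
  (* The cycle lengths are [i] and [s.+1 - j], so oddness of the second makes [s - j] even. *)
  rewrite !size_map !size_iota subn1 /= => odd_i odd_sj [sigma].
  have altC := alternating_bicycle_color altD.
  have [dec _ _ _] := altD; have [_ _ /andP[i_bd j_bd] _ _] := dec.
  rewrite (adapted_bicycle c _ dec).
  apply: proper_odd_not_adapted altC _ _ odd_i _; lia.
move=> [altD lt_ji]; rewrite /improper in lt_ji.
have altC := alternating_bicycle_color altD.
have [dec _ _ _] := altD; have [uniqP _ /andP[i_bd j_bd] _ _] := dec.
have [||tau ad_tau] := @improper_adapted s i j _ altC; try lia.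
have [sigma sigmaE] := color_of_indices tau uniqP.
exists sigma; rewrite (adapted_bicycle c _ dec).
exact: adapted_indices_ext ad_tau.
Qed.
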